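(* Let $X,Y$ be metric spaces, $F:X\rightrightarrows Y$ a multifunction and $(\overline{x},\overline{y})\in\operatorname{Gr}F$. Then the following are equivalent: (a) $F$ is linearly pseudo-open at $(\overline{x},\overline{y})$; (b) $F^{-1}$ is calm at $(\overline{y},\overline{x})$; (c) $F$ is metrically subregular at $(\overline{x},\overline{y})$. Moreover, in each of these situations, $$(\operatorname{lpo}F(\overline{x},\overline{y}))^{-1}=\operatorname{clm}F^{-1}(\overline{y},\overline{x})=\operatorname{subreg}F(\overline{x},\overline{y}).$$
   Context: $B(x,r)$ is the open ball with center $x$ and radius $r$; $\mathcal{V}(x)$ is the set of neighborhoods of $x$. $d(x,A)=\inf_{a\in A}d(x,a)$ with $d(x,\emptyset)=\infty$; the excess is $e(A,B)=\sup\{d(a,B)\mid a\in A\}$ (with $e(\emptyset,B)=0$). For $F:X\rightrightarrows Y$: $\operatorname{Gr}F=\{(x,y)\mid y\in F(x)\}$, $F(A)=\bigcup_{x\in A}F(x)$, $F^{-1}(y)=\{x\mid y\in F(x)\}$. Let $L>0$ and $(\overline{x},\overline{y})\in\operatorname{Gr}F$. (i) $F$ is linearly pseudo-open with modulus $L$ at $(\overline{x},\overline{y})$ if there exist $U\in\mathcal{V}(\overline{x})$ and $\varepsilon>0$ such that for every $\rho\in(0,\varepsilon)$ and every $x\in U\cap F^{-1}(B(\overline{y},L\rho))$ one has $\overline{y}\in F(B(x,\rho))$. The supremum of such $L$ (over all combinations $(L,U,\varepsilon)$) is $\operatorname{lpo}F(\overline{x},\overline{y})$. (ii) $F$ is calm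 with constant $L$ at $(\overline{x},\overline{y})$ if there exist $U\in\mathcal{V}(\overline{x})$, $V\in\mathcal{V}(\overline{y})$ such that $e(F(x)\cap V,F(\overline{x}))\leq L\,d(x,\overline{x})$ for every $x\in U$. The infimum of such $L$ is $\operatorname{clm}F(\overline{x},\overline{y})$. (iii) $F$ is metrically subregular with constant $L$ at $(\overline{x},\overline{y})$ if there exists $U\in\mathcal{V}(\overline{x})$ such that $d(x,F^{-1}(\overline{y}))\leq L\,d(\overline{y},F(x))$ for every $x\in U$. The infimum of such $L$ is $\operatorname{subreg}F(\overline{x},\overline{y})$. Each property without mention of a constant means that it holds for some $L>0$. Convention: $(+\infty)^{-1}=0$. *)

(* Defs.v *)
From mathcomp Require Import all_boot all_order all_algebra.
From mathcomp Require Import all_classical all_reals all_analysis.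
Set Implicit Arguments.
Unset Strict Implicit.
Unset Printing Implicit Defensive.
Import Order.TTheory GRing.Theory Num.Theory.
Local Open Scope classical_set_scope.
Local Open Scope ring_scope.

Definition mgraph {X Y : Type} (F : X -> set Y) : set (X * Y) :=
  [set p | F p.1 p.2].

Definition mimage {X Y : Type} (F : X -> set Y) (A : set X) : set Y :=
  \bigcup_(x in A) F x.

Definition minverse {X Y : Type} (F : X -> set Y) : Y -> set X :=
  fun y => [set x | F x y].

Section Distances.
Context {R : realType} {X : metricType R}.

(* Equal to +oo when A is empty, as the library sets [ereal_inf set0 = +oo]. *)
Definition setdist (x : X) (A : set X) : \bar R :=
  ereal_inf [set (mdist x a)%:E | a in A].

(* The empty case is separate because the library sets [ereal_sup set0 = -oo]. *)
Definition excess (A B : set X) : \bar R :=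
  if A == set0 then 0%E else ereal_sup [set setdist a B | a in A].

End Distances.

Section Regularity.
Context {R : realType} {X Y : metricType R}.
Implicit Types (F : X -> set Y) (xbar : X) (ybar : Y) (L : R).

Definition linearly_pseudo_open_with F xbar ybar L : Prop :=
  exists U : set X, nbhs xbar U /\
  exists2 eps : R, 0 < eps &
  forall rho : R, 0 < rho < eps ->
  forall x : X, (U `&` mimage (minverse F) (ball ybar (L * rho))) x ->
  mimage F (ball x rho) ybar.

Definition calm_with F xbar ybar L : Prop :=
  exists (U : set X) (V : set Y), [/\ nbhs xbar U, nbhs ybar V &
  forall x : X, U x ->
    (excess (F x `&` V) (F xbar) <= (L * mdist x xbar)%:E)%E].

Definition metrically_subregular_with F xbar ybar L : Prop :=
  exists U : set X, nbhs xbar U /\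
  forall x : X, U x ->
    (setdist x (minverse F ybar) <= L%:E * setdist ybar (F x))%E.

Definition linearly_pseudo_open F xbar ybar : Prop :=
  exists2 L : R, 0 < L & linearly_pseudo_open_with F xbar ybar L.

Definition calm F xbar ybar : Prop :=
  exists2 L : R, 0 < L & calm_with F xbar ybar L.

Definition metrically_subregular F xbar ybar : Prop :=
  exists2 L : R, 0 < L & metrically_subregular_with F xbar ybar L.

Definition lpo F xbar ybar : \bar R :=
  ereal_sup [set L%:E | L in
    [set L : R | 0 < L /\ linearly_pseudo_open_with F xbar ybar L]].

Definition clm F xbar ybar : \bar R :=
  ereal_inf [set L%:E | L in
    [set L : R | 0 < L /\ calm_with F xbar ybar L]].

Definition subreg F xbar ybar : \bar R :=
  ereal_inf [set L%:E | L in
    [set L : R | 0 < L /\ metrically_subregular_with F xbar ybar L]].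

End Regularity.

(* Main.v *)
(* For every single constant, calmness of F^-1 with constant L, metric
   subregularity of F with constant L, and linear pseudo-openness of F with
   modulus 1/L are equivalent; the identities between the exact moduli follow
   since inversion turns a supremum of positive numbers into an infimum.
   For calmness => subregularity, pairs (x, y) with y far from ybar are harmless:
   d(x, F^-1(ybar)) <= d(x, xbar) is then small compared with d(ybar, F x). *)
Require Import Defs.
From mathcomp Require Import all_boot all_order all_algebra.
From mathcomp Require Import all_classical all_reals all_analysis.
Set Implicit Arguments.
Unset Strict Implicit.
Unset Printing Implicit Defensive.
Import Order.TTheory GRing.Theory Num.Theory.
Local Open Scope classical_set_scope.
Local Open Scope ring_scope.

(** Inversion is an order-reversing involution of [0, +oo] exchanging 0 and +oo. Nonemptiness keeps
    the supremum away from -oo. *)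
Lemma inve_ereal_sup (R : realType) (S : set (\bar R)) : S !=set0 ->
  (forall x, S x -> (0 <= x)%E) ->
  (ereal_sup S)^-1%E = ereal_inf [set x^-1%E | x in S].
Proof.
move=> [x0 Sx0] S_ge0.
have sup_ge0 : (0 <= ereal_sup S)%E.
  exact: le_trans (S_ge0 _ Sx0) (ereal_sup_ubound Sx0).
have inf_ge0 : (0 <= ereal_inf [set x^-1%E | x in S])%E.
  by apply: le_ereal_inf_tmp => _ [x Sx <-]; rewrite inve_ge0 S_ge0.
apply/eqP; rewrite eq_le; apply/andP; split.
  apply: le_ereal_inf_tmp => _ [x Sx <-].
  by have x_ge0 := S_ge0 _ Sx; rewrite lee_pV2 ?inE//; exact: ereal_sup_ubound.
rewrite inve_pge ?inE//; apply: ge_ereal_sup => x Sx.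
have x_ge0 := S_ge0 _ Sx; rewrite inve_pge ?inE//; apply: ereal_inf_lbound.
by exists x.
Qed.

Lemma setdist_le (R : realType) (Z : metricType R) (x a : Z) (A : set Z) :
  A a -> (setdist x A <= (mdist x a)%:E)%E.
Proof. by move=> Aa; apply: ereal_inf_lbound; exists a. Qed.

Lemma setdist_ltP (R : realType) (Z : metricType R) (x : Z) (A : set Z) (r : R) :
  (setdist x A < r%:E)%E <-> exists2 a, A a & mdist x a < r.
Proof.
split=> [/ereal_inf_lt[_ [a Aa <-]]|[a Aa xa]].
  by rewrite lte_fin => xa; exists a.
by apply: le_lt_trans (setdist_le x Aa) _; rewrite lte_fin.
Qed.

Section Regularity.
Context {R : realType} {X Y : metricType R}.
Variables (F : X -> set Y) (xbar : X) (ybar : Y).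

(** Pointwise form of calmness, free of excesses, through which the other two properties are
    compared with it. *)
Lemma calm_minverseP (L : R) : 0 <= L ->
  calm_with (minverse F) ybar xbar L <->
  exists2 U, nbhs xbar U & exists2 delta : R, 0 < delta &
    forall x y, U x -> F x y -> mdist y ybar < delta ->
    (setdist x (minverse F ybar) <= (L * mdist y ybar)%:E)%E.
Proof.
move=> L_ge0; split=> [[V [U [/nbhs_ballP[delta /= delta_gt0 dV] nU calmF]]]|].
  exists U => //; exists delta => // x y Ux Fxy ylt.
  have Vy : V y by apply: dV; rewrite ballEmdist /= metric_sym.
  apply: le_trans (calmF y Vy); rewrite /excess; case: eqP => [E0|_].
    by have : (minverse F y `&` U) x by []; rewrite E0.
  by apply: ereal_sup_ubound; exists x.
move=> [U nU [delta delta_gt0 calmF]].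
exists (ball ybar delta), U; split => //; first exact: nbhsx_ballx.
move=> y; rewrite ballEmdist /= metric_sym => ylt; rewrite /excess.
(* An empty intersection has excess 0, so this case rests on [0 <= L]. *)
case: eqP => _; first by rewrite lee_fin mulr_ge0// mdist_ge0.
by apply: ge_ereal_sup => _ [x [Fxy Ux] <-]; exact: calmF.
Qed.

Lemma pseudo_open_calm (L : R) : 0 < L ->
  linearly_pseudo_open_with F xbar ybar L <->
  calm_with (minverse F) ybar xbar L^-1.
Proof.
move=> L_gt0; have LV_ge0 : 0 <= L^-1 by rewrite invr_ge0 ltW.
apply: iff_trans (iff_sym (calm_minverseP LV_ge0)).
split=> [[U [nU [eps eps_gt0 openF]]]|[U nU [delta delta_gt0 calmF]]].
  exists U => //; exists (L * eps); first exact: mulr_gt0.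
  move=> x y Ux Fxy ylt.
  apply/lee_addgt0Pr => e e_gt0; rewrite -EFinD leNgt; apply/negP => dgt.
  (* Openness needs a radius strictly between d(y, ybar) / L and [eps], which the midpoint provides;
     the minimum also keeps it within [e] of the lower end, contradicting [dgt]. *)
  pose rho :=
    Num.min (L^-1 * mdist y ybar + e) ((L^-1 * mdist y ybar + eps) / 2).
  have d_ge0 : 0 <= L^-1 * mdist y ybar by rewrite mulr_ge0 ?mdist_ge0.
  have d_lt : L^-1 * mdist y ybar < eps.
    by rewrite mulrC ltr_pdivrMr// mulrC.
  have rho_gt : L^-1 * mdist y ybar < rho.
    by rewrite lt_min ltrDl e_gt0 midf_lt.
  have rho_lt : rho < eps by rewrite gt_min midf_lt// orbT.
  have : mimage F (ball x rho) ybar.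
    apply: openF; first by rewrite (le_lt_trans d_ge0).
    split => //; exists y => //; rewrite ballEmdist /= metric_sym.
    by rewrite mulrC -ltr_pdivrMr// mulrC.
  move=> [a]; rewrite ballEmdist /= => xa Fa.
  have : (setdist x (minverse F ybar) < (L^-1 * mdist y ybar + e)%:E)%E.
    apply/setdist_ltP; exists a => //; apply: lt_le_trans xa _.
    by rewrite ge_min lexx.
  by move/(lt_trans dgt); rewrite ltxx.
(* With this bound on [rho], d(y, ybar) < L rho forces d(y, ybar) < [delta]. *)
exists U; split => //; exists (delta / L); first exact: divr_gt0.
move=> rho /andP[rho_gt0 rho_lt] x [Ux [y]].
rewrite ballEmdist /= metric_sym => ylt Fxy.
have /setdist_ltP[a Fa xa] : (setdist x (minverse F ybar) < rho%:E)%E.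
  apply: le_lt_trans (calmF x y Ux Fxy _) _.
    by apply: lt_trans ylt _; rewrite mulrC -ltr_pdivlMr.
  by rewrite lte_fin mulrC ltr_pdivrMr// mulrC.
by exists a => //; rewrite ballEmdist.
Qed.

Lemma subregular_calm (L : R) : 0 < L -> F xbar ybar ->
  metrically_subregular_with F xbar ybar L <->
  calm_with (minverse F) ybar xbar L.
Proof.
move=> L_gt0 Fbar; apply: iff_trans (iff_sym (calm_minverseP (ltW L_gt0))).
split=> [[U [nU subF]]|[U nU [delta delta_gt0 calmF]]].
  (* Subregularity bounds the distance for every y in F x, so any positive [delta] would do. *)
  exists U => //; exists 1 => // x y Ux Fxy _.
  apply: le_trans (subF x Ux) _.
  by rewrite EFinM lee_pmul2l ?lte_fin// metric_sym setdist_le.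
have Ld_gt0 : 0 < L * delta by exact: mulr_gt0.
(* The radius is chosen for y with d(y, ybar) >= [delta]: as xbar lies in F^-1(ybar), d(x,
   F^-1(ybar)) <= d(x, xbar) < L delta <= L d(y, ybar). *)
exists (U `&` ball xbar (L * delta)); split.
  by apply: filterI => //; exact: nbhsx_ballx.
move=> x [Ux]; rewrite ballEmdist /= metric_sym => x_near.
(* Moving L to the left isolates the infimum, which is then bounded below one y at a time; an empty
   F x leaves nothing to check. *)
rewrite muleC -lee_pdivrMr//; apply: le_ereal_inf_tmp => _ [y Fxy <-].
rewrite lee_pdivrMr// muleC -EFinM metric_sym.
have [ylt|yge] := ltP (mdist y ybar) delta; first exact: calmF.
apply: le_trans (setdist_le x Fbar) _; rewrite lee_fin.
by apply: le_trans (ltW x_near) _; rewrite ler_pM2l.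
Qed.

End Regularity.

Theorem proposition2p7 (R : realType) (X Y : metricType R) (F : X -> set Y)
    (xbar : X) (ybar : Y) (hgraph : mgraph F (xbar, ybar)) :
  [<-> linearly_pseudo_open F xbar ybar;
       calm (minverse F) ybar xbar;
       metrically_subregular F xbar ybar]
  /\
  (linearly_pseudo_open F xbar ybar \/ calm (minverse F) ybar xbar \/
     metrically_subregular F xbar ybar ->
   (lpo F xbar ybar)^-1%E = clm (minverse F) ybar xbar /\
   clm (minverse F) ybar xbar = subreg F xbar ybar).
Proof.
have lpo_calm : linearly_pseudo_open F xbar ybar -> calm (minverse F) ybar xbar.
  move=> [L L_gt0 /(pseudo_open_calm _ _ _ L_gt0) ?].
  by exists L^-1; rewrite ?invr_gt0.
have calm_sub :
    calm (minverse F) ybar xbar -> metrically_subregular F xbar ybar.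
  by move=> [L L_gt0 /(subregular_calm L_gt0 hgraph) ?]; exists L.
have sub_lpo :
    metrically_subregular F xbar ybar -> linearly_pseudo_open F xbar ybar.
  move=> [L L_gt0 /(subregular_calm L_gt0 hgraph) calmF].
  have LV_gt0 : 0 < L^-1 by rewrite invr_gt0.
  by exists L^-1 => //; apply/pseudo_open_calm; rewrite ?invrK.
split; first by tfae.
move=> anyF.
(* Whichever property is assumed, the set of moduli defining [lpo] is nonempty. *)
have [L0 L0_gt0 openF] : linearly_pseudo_open F xbar ybar.
  by case: anyF => [//|[/calm_sub|]] /sub_lpo.
split.
  rewrite /lpo inve_ereal_sup; last first.
  - by move=> _ [L [L_gt0 _] <-]; rewrite lee_fin ltW.
  - by exists L0%:E, L0.
  congr ereal_inf; rewrite image_comp; apply/seteqP; split=> _ [L [L_gt0 HL] <-].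
    (* The map L to 1/L matches moduli with calmness constants; L > 0 makes the extended inverse the
       real one. *)
    exists L^-1; last by rewrite /= inver gt_eqF.
    by split; [rewrite invr_gt0 | exact/pseudo_open_calm].
  have LV_gt0 : 0 < L^-1 by rewrite invr_gt0.
  exists L^-1; last by rewrite /= inver gt_eqF ?invrK.
  by split => //; apply/pseudo_open_calm; rewrite ?invrK.
congr ereal_inf; apply/seteqP; split=> _ [L [L_gt0 HL] <-]; exists L => //;
  by split => //; exact/(subregular_calm L_gt0 hgraph).
Qed.
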